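(* Let $H$ be a finite dimensional complex Hilbert space and let $\mathcal{S}\subseteq \mathcal{L}(H)$ be an operator system. Then $$\mathrm{ap}(\mathcal{S}) \subseteq \mathrm{th}(\mathcal{S}) \subseteq \mathrm{fp}(\mathcal{S})^{\sharp}.$$
   Context: $\mathcal{L}(H)$ is the algebra of all linear operators on $H$, with the operator norm; $\mathcal{L}(H)^+$ is its cone of positive semidefinite operators; $M_k$ is the algebra of complex $k\times k$ matrices. An operator system (also called a non-commutative graph) in $\mathcal{L}(H)$ is a linear subspace $\mathcal{S}$ with $I\in\mathcal{S}$ and $A^*\in\mathcal{S}$ whenever $A\in\mathcal{S}$. ''Projection'' means orthogonal projection. A projection $P\in\mathcal{L}(H)$ is $\mathcal{S}$-abelian if $P\mathcal{S}P$ is contained in an abelian C*-subalgebra of $\mathcal{L}(H)$; it is $\mathcal{S}$-full if $\mathcal{L}(PH)\oplus 0_{P^\perp}\subseteq\mathcal{S}$ (i.e. every $A\in \mathcal{L}(H)$ with $A=PAP$ lies in $\mathcal{S}$). For $\mathcal{C}\subseteq\mathcal{L}(H)$, $\mathrm{her}(\mathcal{C})=\{A\in\mathcal{L}(H)^+ : \exists B\in\mathcal{C},\ A\le B\}$. Set $\mathrm{ap}(\mathcal{S})=\mathrm{her}(\overline{\mathrm{conv}}\{P: P \text{ an } \mathcal{S}\text{-abelian projection}\})$ and $\mathrm{fp}(\mathcal{S})=\mathrm{her}(\overline{\mathrm{conv}}\{P: P \text{ an } \mathcal{S}\text{-full projection}\})$. For a non-empty $\mathcal{A}\subseteq\mathcal{L}(H)^+$,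 $\mathcal{A}^\sharp=\{B\in\mathcal{L}(H)^+ : \mathrm{Tr}(AB)\le 1 \text{ for all } A\in\mathcal{A}\}$. A quantum channel is a completely positive trace preserving linear map. If $\Phi:\mathcal{L}(H)\to M_k$ is completely positive with Kraus representation $\Phi(T)=\sum_{p=1}^m A_pTA_p^*$, put $\mathcal{S}_\Phi=\mathrm{span}\{A_p^*A_q : p,q=1,\dots,m\}$ (independent of the Kraus representation). Let $\mathfrak{C}(\mathcal{S})$ be the set of all quantum channels $\Phi:\mathcal{L}(H)\to M_k$, $k\in\mathbb{N}$ arbitrary, with $\mathcal{S}_\Phi\subseteq\mathcal{S}$, and $$\mathrm{th}(\mathcal{S})=\{T\in\mathcal{L}(H)^+ : \Phi(T)\le I \text{ for every } \Phi\in\mathfrak{C}(\mathcal{S})\}.$$ *)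

(* Defs.v *)
From HB Require Import structures.
From mathcomp Require Import all_boot all_order all_algebra complex.
From mathcomp Require Import all_classical all_reals all_analysis.
Import Order.TTheory GRing.Theory Num.Theory.
Import numFieldNormedType.Exports.

Set Implicit Arguments.
Unset Strict Implicit.
Unset Printing Implicit Defensive.

Local Open Scope classical_set_scope.
Local Open Scope ring_scope.
Local Open Scope sesquilinear_scope.

(* A finite dimensional complex Hilbert space H is taken to be C^n with its
   standard inner product, n arbitrary (possibly 0), so that L(H) is 'M[R[i]]_n
   acting on column vectors, with adjoint A ^t*.  As H is finite dimensional,
   every linear subspace of L(H) is closed. *)

(* In R[i], 0 <= z says that z is real and nonnegative, so that a psd matrix is
   automatically Hermitian. *)
Definition psd (R : realType) n (A : 'M[R[i]]_n) : Prop :=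
  forall v : 'cV[R[i]]_n, 0 <= (v ^t* *m A *m v) 0 0.

Definition loewner (R : realType) n (A B : 'M[R[i]]_n) : Prop := psd (B - A).

Definition projection (R : realType) n (P : 'M[R[i]]_n) : Prop :=
  P *m P = P /\ P ^t* = P.

Definition operator_system (R : realType) n (S : {vspace 'M[R[i]]_n}) : Prop :=
  1%:M \in S /\ forall A, A \in S -> A ^t* \in S.

Definition abelian_Cstar_subalgebra (R : realType) n
    (D : {vspace 'M[R[i]]_n}) : Prop :=
  [/\ forall A B, A \in D -> B \in D -> A *m B \in D,
      forall A, A \in D -> A ^t* \in D
    & forall A B, A \in D -> B \in D -> A *m B = B *m A].

Definition abelian_projection (R : realType) n (S : {vspace 'M[R[i]]_n})
    (P : 'M[R[i]]_n) : Prop :=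
  projection P /\
  exists2 D : {vspace 'M[R[i]]_n}, abelian_Cstar_subalgebra D &
    forall A, A \in S -> P *m A *m P \in D.

Definition full_projection (R : realType) n (S : {vspace 'M[R[i]]_n})
    (P : 'M[R[i]]_n) : Prop :=
  projection P /\ forall A, A = P *m A *m P -> A \in S.

Definition convex_hull (R : realType) n (E : set 'M[R[i]]_n) :
    set 'M[R[i]]_n :=
  [set X | exists m (w : 'I_m -> R) (Y : 'I_m -> 'M[R[i]]_n),
    [/\ forall i, 0 <= w i, \sum_i w i = 1, forall i, E (Y i)
      & X = \sum_i real_complex R (w i) *: Y i]].

(* The library puts a topology on R[i]^o but not on its copy R[i].  The induced
   topology on matrices is the entrywise one, which is also the topology of the
   operator norm, all norms on 'M[R[i]]_n being equivalent. *)
Definition closed_convex_hull (R : realType) n (E : set 'M[R[i]]_n) :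
    set 'M[R[i]]_n :=
  @closure 'M[R[i]^o]_n (convex_hull E).

Definition her (R : realType) n (E : set 'M[R[i]]_n) : set 'M[R[i]]_n :=
  [set A | psd A /\ exists2 B, E B & loewner A B].

Definition ap (R : realType) n (S : {vspace 'M[R[i]]_n}) : set 'M[R[i]]_n :=
  her (closed_convex_hull [set P | abelian_projection S P]).

Definition fp (R : realType) n (S : {vspace 'M[R[i]]_n}) : set 'M[R[i]]_n :=
  her (closed_convex_hull [set P | full_projection S P]).

(* In R[i], z <= 1 says that z is real and at most 1; the trace of a product of
   two psd matrices is real. *)
Definition sharp (R : realType) n (E : set 'M[R[i]]_n) : set 'M[R[i]]_n :=
  [set B | psd B /\ forall A, E A -> \tr (A *m B) <= 1].

(* id_m (x) Phi is positive for all m, where M_m (x) L(H) is identified with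
   the m x m block matrices with blocks in L(H). *)
Definition completely_positive (R : realType) n k
    (Phi : 'M[R[i]]_n -> 'M[R[i]]_k) : Prop :=
  forall m (X : 'I_m -> 'I_m -> 'M[R[i]]_n),
    psd (\mxblock_(i < m, j < m) X i j) ->
    psd (\mxblock_(i < m, j < m) Phi (X i j)).

Definition trace_preserving (R : realType) n k
    (Phi : 'M[R[i]]_n -> 'M[R[i]]_k) : Prop :=
  forall T, \tr (Phi T) = \tr T.

Definition quantum_channel (R : realType) n k
    (Phi : {linear 'M[R[i]]_n -> 'M[R[i]]_k}) : Prop :=
  completely_positive Phi /\ trace_preserving Phi.

Definition kraus_representation (R : realType) n k
    (Phi : 'M[R[i]]_n -> 'M[R[i]]_k) m (A : 'I_m -> 'M[R[i]]_(k, n)) : Prop :=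
  forall T, Phi T = \sum_p A p *m T *m (A p) ^t*.

(* The span of the products A_p^* A_q depends only on Phi, and not on its Kraus
   representation A: the union below is that of a constant family. *)
Definition channel_graph (R : realType) n k
    (Phi : 'M[R[i]]_n -> 'M[R[i]]_k) : set 'M[R[i]]_n :=
  [set X | exists m (A : 'I_m -> 'M[R[i]]_(k, n)),
    kraus_representation Phi A /\
    X \in <<[seq (A pq.1) ^t* *m A pq.2 | pq : 'I_m * 'I_m]>>%VS].

Definition channels (R : realType) n (S : {vspace 'M[R[i]]_n}) k :
    set {linear 'M[R[i]]_n -> 'M[R[i]]_k} :=
  [set Phi | quantum_channel Phi /\ channel_graph Phi `<=` [set` S]].

Definition th (R : realType) n (S : {vspace 'M[R[i]]_n}) : set 'M[R[i]]_n :=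
  [set T | psd T /\
    forall k (Phi : {linear 'M[R[i]]_n -> 'M[R[i]]_k}),
      channels S Phi -> loewner (Phi T) 1%:M].

(* Main.v *)
From HB Require Import structures.
Require Import Defs.
From mathcomp Require Import all_boot all_order all_algebra complex.
From mathcomp Require Import all_classical all_reals all_analysis.
From mathcomp Require Import ring.
Import Order.TTheory GRing.Theory Num.Theory.
Import numFieldNormedType.Exports.
Set Implicit Arguments.
Unset Strict Implicit.
Unset Printing Implicit Defensive.
Local Open Scope classical_set_scope.
Local Open Scope ring_scope.
Local Open Scope sesquilinear_scope.

(** Both inclusions reduce to projections. The conditions to be proved on X in
    the closed convex hull, v^* Phi(X) v <= v^* v for the first inclusion and
    tr(XT) <= 1 for the second, are linear in X, so they follow from their
    truth at the generating projections [closed_hull_le]. They pass to the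
    hereditary cover because channels are positive and because the trace of a
    product of psd matrices is nonnegative.

    First inclusion. Let P be S-abelian and Phi a channel with graph in S, with
    Kraus operators A_p provided by Choi's theorem [choi]. The matrices
    P A_p^* A_q P commute and form a family closed under adjoints, so one
    orthonormal basis (u_i) diagonalizes them all
    [commuting_diagonalization]. With e_i = P u_i we have P = sum_i e_i e_i^*,
    and the diagonal form says that A_p e_i is orthogonal to A_q e_j whenever
    i <> j. So the images K_i of e_i e_i^* under Phi are psd, have trace at
    most 1 since Phi preserves traces, and K_i K_j = 0 for i <> j. A psd K with
    trace at most 1 satisfies K^2 <= K; summing, Q = Phi(P) satisfies Q^2 <= Q,
    hence Q <= 1 [psd_contraction].

    Second inclusion. Let P be S-full. The map X |-> tr(PX) (+) (1-P)X(1-P) is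
    a channel [corner_channel] with Kraus operators f_j P, where f_j is the
    j-th coordinate functional sent into the first output coordinate, and 1-P,
    sent into the other ones. The products of Kraus operators are P E_ij P, 1-P
    and 0, all in S. Applied to T in th(S), the condition Phi(T) <= 1 contains
    tr(PT) <= 1 in its first diagonal entry. That the graph may be computed
    from this particular Kraus family is [kraus_span]: the Kraus operators of
    one representation are linear combinations of those of any other, because
    the Gram matrix of their vectorizations is determined by Phi. *)

(** * Adjoints and quadratic forms *)

Section Adjoint.
Variable C : numClosedFieldType.

Lemma adjmxM m n p (A : 'M[C]_(m, n)) (B : 'M[C]_(n, p)) :
  (A *m B) ^t* = B ^t* *m A ^t*.
Proof. by rewrite trmx_mul map_mxM. Qed.

Lemma adjmxD m n (A B : 'M[C]_(m, n)) : (A + B) ^t* = A ^t* + B ^t*.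
Proof. by rewrite linearD /= map_mxD. Qed.

Lemma adjmxB m n (A B : 'M[C]_(m, n)) : (A - B) ^t* = A ^t* - B ^t*.
Proof. by rewrite linearB /= map_mxB. Qed.

Lemma adjmxZ m n a (A : 'M[C]_(m, n)) : (a *: A) ^t* = a^* *: A ^t*.
Proof. by rewrite linearZ /= map_mxZ. Qed.

Lemma adjmx1 n : (1%:M : 'M[C]_n) ^t* = 1%:M.
Proof. by rewrite trmx1 map_mx1. Qed.

Lemma adjmx_sum m n (I : finType) (A : I -> 'M[C]_(m, n)) :
  (\sum_i A i) ^t* = \sum_i (A i) ^t*.
Proof. by rewrite linear_sum map_mx_sum. Qed.

Lemma adjmx_delta m n i j : (delta_mx i j : 'M[C]_(m, n)) ^t* = delta_mx j i.
Proof. by rewrite trmx_delta map_delta_mx. Qed.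

Lemma mx_delta_delta m n (A : 'M[C]_(m, n)) i j :
  ((delta_mx i 0 : 'cV[C]_m) ^t* *m A *m (delta_mx j 0 : 'cV[C]_n)) 0 0 = A i j.
Proof. by rewrite adjmx_delta -rowE -colE !mxE. Qed.

(** Polarization over the complex numbers: the vectors e_i + c e_j with c = 1 and
    c = 'i isolate the entry B i j. *)
Lemma quad_form_eq0 n (B : 'M[C]_n) :
  (forall v : 'cV[C]_n, (v ^t* *m B *m v) 0 0 = 0) -> B = 0.
Proof.
move=> B0; apply/matrixP => i j; rewrite [RHS]mxE.
have diag0 k : B k k = 0 by rewrite -mx_delta_delta B0.
have cross c : c * B i j + c^* * B j i = 0.
  have := B0 (delta_mx i 0 + c *: delta_mx j 0).
  rewrite adjmxD adjmxZ !mulmxDl !mulmxDr -!scalemxAl -!scalemxAr.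
  rewrite ![((_ + _ : 'M[C]__) 0 0)]mxE ![((_ *: _ : 'M[C]__) 0 0)]mxE.
  by rewrite !mx_delta_delta !diag0 !(mulr0, addr0, add0r).
have := cross 1; rewrite conjC1 !mul1r => /eqP; rewrite addr_eq0 => /eqP Bij.
have /eqP := cross 'i; rewrite conjCi Bij mulNr mulrN -opprD oppr_eq0.
rewrite -mulr2n mulrn_eq0 /= mulf_eq0 (negbTE (neq0Ci _)) /= => /eqP ->.
by rewrite oppr0.
Qed.

Lemma sqnorm_ge0 n (v : 'cV[C]_n) : 0 <= (v ^t* *m v) 0 0.
Proof. by rewrite mxE sumr_ge0// => i _; rewrite !mxE mulrC mul_conjC_ge0. Qed.

Lemma sqnorm_eq0 n (v : 'cV[C]_n) : (v ^t* *m v) 0 0 = 0 -> v = 0.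
Proof.
rewrite mxE => /eqP; rewrite psumr_eq0; last first.
  by move=> i _; rewrite !mxE mulrC mul_conjC_ge0.
move=> /allP v0; apply/colP => i; rewrite [RHS]mxE.
have := v0 i (mem_index_enum _).
by rewrite !mxE /= mulrC mul_conjC_eq0 => /eqP.
Qed.

End Adjoint.

(** * Positive semidefinite matrices *)

Section ComplexMatrices.
Variable R : realType.
Local Notation C := R[i].

Lemma psd_gram m n (A : 'M[C]_(m, n)) : psd (A ^t* *m A).
Proof. by move=> v; rewrite -mulmxA -mulmxA mulmxA -adjmxM sqnorm_ge0. Qed.

Lemma psdD n (A B : 'M[C]_n) : psd A -> psd B -> psd (A + B).
Proof.
by move=> hA hB v; rewrite mulmxDr mulmxDl mxE addr_ge0// ?hA ?hB.
Qed.

Lemma psd_sum n (I : finType) (A : I -> 'M[C]_n) :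
  (forall i, psd (A i)) -> psd (\sum_i A i).
Proof.
move=> hA v; rewrite mulmx_sumr mulmx_suml summxE sumr_ge0// => i _; exact: hA.
Qed.

Lemma psd_conj m n (A : 'M[C]_m) (B : 'M[C]_(n, m)) : psd A -> psd (B *m A *m B ^t*).
Proof.
move=> hA v; have := hA (B ^t* *m v).
by rewrite adjmxM trmxCK !mulmxA.
Qed.

(** A real quadratic form takes equal values at A and at its adjoint. *)
Lemma psd_hermitian n (A : 'M[C]_n) : psd A -> A ^t* = A.
Proof.
move=> hA; apply/eqP; rewrite -subr_eq0; apply/eqP.
apply: quad_form_eq0 => v; rewrite mulmxBr mulmxBl mxE [X in _ + X]mxE.
apply/eqP; rewrite subr_eq0; apply/eqP.
rewrite -[RHS](CrealP (ger0_real (hA v))).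
have -> : v ^t* *m A ^t* *m v = (v ^t* *m A *m v) ^t*.
  by rewrite !adjmxM trmxCK mulmxA.
by rewrite [LHS]mxE [X in X^*]mxE.
Qed.

Lemma psd_spectral n (A : 'M[C]_n) : psd A ->
  exists (U : 'M[C]_n) (d : 'rV[C]_n),
  [/\ U \is unitarymx, forall i, 0 <= d 0 i & A = U ^t* *m diag_mx d *m U].
Proof.
move=> hA.
have /orthomx_spectralP AE : A \is normalmx.
  by apply/normalmxP; rewrite psd_hermitian.
have Uu := spectral_unitarymx A; rewrite invmx_unitary// in AE.
exists (spectralmx A), (spectral_diag A); split=> // i.
have := psd_conj (spectralmx A) hA.
move=> /(_ (delta_mx i 0)); rewrite mx_delta_delta {2}AE !mulmxA.
by rewrite (unitarymxP Uu) mul1mx mulmxtVK// mxE eqxx mulr1n.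
Qed.

Lemma diag_psd n (d : 'rV[C]_n) : (forall i, 0 <= d 0 i) -> psd (diag_mx d).
Proof.
move=> d0 v; rewrite mul_mx_diag mxE sumr_ge0// => i _.
by rewrite !mxE mulrAC mulr_ge0// mulrC mul_conjC_ge0.
Qed.

(** The vectors are eigenvectors of A scaled by the square roots of their
    eigenvalues. *)
Lemma psd_rank1_sum n (A : 'M[C]_n) : psd A ->
  exists w : 'I_n -> 'cV[C]_n, A = \sum_r w r *m (w r) ^t*.
Proof.
move=> /psd_spectral[U [d [_ d0 ->]]].
exists (fun r => sqrtC (d 0 r) *: (row r U) ^t*).
apply/matrixP => i j; rewrite mul_mx_diag mxE summxE; apply: eq_bigr => r _.
have sd : (sqrtC (d 0 r))^* = sqrtC (d 0 r).
  by apply/CrealP/ger0_real; rewrite sqrtC_ge0.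
rewrite !mxE big_ord1 !mxE rmorphM /= conjCK sd mulrACA -expr2 sqrtCK.
by rewrite mulrA [_^* * _]mulrC.
Qed.

(** Written as a sum of w w^*, B reduces the trace to values w^* A w of the form
    of A. *)
Lemma trace_psd_ge0 n (A B : 'M[C]_n) : psd A -> psd B -> 0 <= \tr (A *m B).
Proof.
move=> hA /psd_rank1_sum[w ->]; rewrite mulmx_sumr raddf_sum sumr_ge0//= => r _.
by rewrite mulmxA mxtrace_mulC mulmxA trace_mx11; exact: hA.
Qed.

(** Each eigenvalue d of K lies between 0 and the trace, so d^2 <= d. *)
Lemma psd_square_le n (K : 'M[C]_n) : psd K -> \tr K <= 1 -> psd (K - K *m K).
Proof.
move=> /psd_spectral[U [d [Uu d0 ->]]].
rewrite mxtrace_mulC mulmxA (unitarymxP Uu) mul1mx mxtrace_diag => d1.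
have -> : U ^t* *m diag_mx d *m U *m (U ^t* *m diag_mx d *m U) =
    U ^t* *m (diag_mx d *m diag_mx d) *m U.
  by rewrite !mulmxA mulmxtVK.
rewrite -mulmxBl -mulmxBr -[X in _ *m X]trmxCK; apply: psd_conj.
rewrite mulmx_diag -linearB; apply: diag_psd => i; rewrite !mxE subr_ge0.
rewrite -[leRHS]mulr1 ler_wpM2l//; apply: le_trans d1.
by rewrite (bigD1 i)//= lerDl sumr_ge0.
Qed.

(** 1 - Q is (1 - Q)^2 + (Q - Q^2), and for Hermitian Q the square is psd. *)
Lemma psd_contraction n (Q : 'M[C]_n) :
  Q ^t* = Q -> psd (Q - Q *m Q) -> psd (1%:M - Q).
Proof.
move=> Qh hQ.
have -> : 1%:M - Q = (1%:M - Q) ^t* *m (1%:M - Q) + (Q - Q *m Q).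
  rewrite adjmxB adjmx1 Qh mulmxBr !mulmxBl !mul1mx mulmx1.
  by rewrite subrK.
by apply: psdD => //; exact: psd_gram.
Qed.

(** * Completely positive maps and Kraus representations *)

Lemma psd_mxblockP m n (X : 'I_m -> 'I_m -> 'M[C]_n) :
  psd (\mxblock_(i < m, j < m) X i j) <->
  forall v : 'I_m -> 'cV[C]_n,
    0 <= (\sum_i \sum_j (v i) ^t* *m X i j *m v j) 0 0.
Proof.
have form v : (\mxcol_i v i) ^t* *m (\mxblock_(i < m, j < m) X i j) *m
    (\mxcol_i v i) = \sum_i \sum_j (v i) ^t* *m X i j *m v j.
  have -> : (\mxcol_i v i) ^t* = \mxrow_i (v i) ^t*.
    by rewrite tr_mxcol; apply/matrixP => i j; rewrite !mxE.
  rewrite mul_mxrow_mxblock mul_mxrow_mxcol exchange_big /=.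
  by apply: eq_bigr => j _; rewrite mulmx_suml.
split=> [hX v | hX v]; first by rewrite -form.
by rewrite -[v]submxcolK form.
Qed.

Lemma kraus_cp m n k (Phi : 'M[C]_n -> 'M[C]_k) (A : 'I_m -> 'M[C]_(k, n)) :
  kraus_representation Phi A -> completely_positive Phi.
Proof.
move=> PhiE l X /psd_mxblockP hX; apply/psd_mxblockP => v.
have -> : \sum_i \sum_j (v i) ^t* *m Phi (X i j) *m v j =
    \sum_p \sum_i \sum_j ((A p) ^t* *m v i) ^t* *m X i j *m ((A p) ^t* *m v j).
  rewrite [RHS]exchange_big; apply: eq_bigr => i _ /=.
  rewrite [RHS]exchange_big; apply: eq_bigr => j _ /=.
  rewrite PhiE mulmx_sumr mulmx_suml; apply: eq_bigr => p _.
  by rewrite adjmxM trmxCK !mulmxA.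
by rewrite summxE sumr_ge0// => p _; exact: hX.
Qed.

Lemma kraus_psd m n k (Phi : 'M[C]_n -> 'M[C]_k) (A : 'I_m -> 'M[C]_(k, n)) T :
  kraus_representation Phi A -> psd T -> psd (Phi T).
Proof. by move=> -> hT; apply: psd_sum => p; exact: psd_conj. Qed.

(** Choi's theorem. The block matrix of matrix units is psd, so its image is a
    sum of rank one matrices w_r w_r^*; cutting w_r into n blocks of length k
    and using these as columns gives the Kraus operator A_r. *)
Lemma choi n k (Phi : {linear 'M[C]_n -> 'M[C]_k}) :
  completely_positive Phi ->
  exists m (A : 'I_m -> 'M[C]_(k, n)), kraus_representation Phi A.
Proof.
move=> cp; have : psd (\mxblock_(i < n, j < n) (delta_mx i j : 'M[C]_n)).
  apply/psd_mxblockP => v; set s : 'M[C]_1 := \sum_i _.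
  (* The matrix unit E_ij is the product of the unit column i and the unit
     row j, which turns the double sum into a squared norm. *)
  have -> : s = (\sum_i (delta_mx 0 i : 'rV[C]_n) *m v i) ^t* *m
                (\sum_i (delta_mx 0 i : 'rV[C]_n) *m v i).
    rewrite adjmx_sum mulmx_suml; apply: eq_bigr => i _.
    rewrite mulmx_sumr; apply: eq_bigr => j _.
    rewrite adjmxM adjmx_delta mulmxA -[_ *m _ *m delta_mx 0 j]mulmxA.
    by rewrite mul_delta_mx.
  exact: sqnorm_ge0.
move=> /cp /psd_rank1_sum [w CE].
exists _, (fun r => \matrix_(a, i) submxcol (w r) i a 0).
set A : _ -> 'M[C]_(k, n) := fun r => _.
have onbasis i j :
    Phi (delta_mx i j) = \sum_r A r *m delta_mx i j *m (A r) ^t*.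
  have /(congr1 (fun M => submxblock M i j)) := CE.
  rewrite mxblockK => ->; rewrite submxblock_sum; apply: eq_bigr => r _.
  rewrite -(mul_delta_mx (0 : 'I_1)) mulmxA -colE -mulmxA.
  rewrite -[delta_mx 0 j]adjmx_delta -adjmxM -colE.
  by apply/matrixP => a b; rewrite !mxE !big_ord1 !mxE.
(* Matrix units span and both sides are linear in T. *)
move=> T; rewrite {1}[T]matrix_sum_delta linear_sum /=.
under eq_bigr => i _ do rewrite linear_sum /=.
under eq_bigr => i _ do under eq_bigr => j _ do rewrite linearZ /= onbasis scaler_sumr.
under eq_bigr => i _ do rewrite exchange_big /=.
rewrite exchange_big; apply: eq_bigr => r _ /=.
rewrite {2}[T]matrix_sum_delta mulmx_sumr mulmx_suml; apply: eq_bigr => i _.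
rewrite mulmx_sumr mulmx_suml; apply: eq_bigr => j _.
by rewrite -scalemxAr -scalemxAl.
Qed.

Lemma gram_eq0 m n (M : 'M[C]_(m, n)) : M ^t* *m M = 0 -> M = 0.
Proof.
move=> MM; apply/matrixP => i j; rewrite [RHS]mxE.
suff /colP/(_ i) : col j M = 0 by rewrite !mxE.
apply: sqnorm_eq0; rewrite colE adjmxM mulmxA -(mulmxA _ (M ^t*)) MM.
by rewrite mulmx0 mul0mx mxE.
Qed.

(** The Gram matrix of M determines the kernel of M, hence its row space. *)
Lemma gram_sub m l n (M : 'M[C]_(m, n)) (N : 'M[C]_(l, n)) :
  M ^t* *m M = N ^t* *m N -> (M <= N)%MS.
Proof.
move=> MN; rewrite submxE; apply/eqP/gram_eq0.
rewrite adjmxM mulmxA -(mulmxA _ (M ^t*)) MN.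
by rewrite -!mulmxA mulmx_coker !mulmx0.
Qed.

(** The Gram matrix of the vectorized Kraus operators lists the entries of the
    images of the matrix units, so it depends on the map alone. *)
Lemma kraus_gram m n k (A : 'I_m -> 'M[C]_(k, n)) a b c d :
  (\sum_p A p *m delta_mx d b *m (A p) ^t*) c a
  = ((\matrix_p mxvec (A p)) ^t* *m \matrix_p mxvec (A p))
      (mxvec_index a b) (mxvec_index c d).
Proof.
rewrite summxE mxE; apply: eq_bigr => p _.
rewrite -(mul_delta_mx (0 : 'I_1)) mulmxA -colE -mulmxA.
rewrite -[delta_mx 0 b]adjmx_delta -adjmxM -colE.
by rewrite !mxE big_ord1 !mxE !mxvecE mulrC.
Qed.

(** Vectorized as the rows of two matrices, the two families have the same Gram
    matrix, hence span the same space. *)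
Lemma kraus_span m l n k (A : 'I_m -> 'M[C]_(k, n)) (B : 'I_l -> 'M[C]_(k, n))
    (Phi : 'M[C]_n -> 'M[C]_k) :
  kraus_representation Phi A -> kraus_representation Phi B ->
  exists D : 'M[C]_(m, l), forall p, A p = \sum_r D p r *: B r.
Proof.
move=> PhiA PhiB.
have /submxP[D AD] : ((\matrix_p mxvec (A p)) <= \matrix_r mxvec (B r))%MS.
  apply: gram_sub; apply/matrixP => s t.
  case/mxvec_indexP: s => a b; case/mxvec_indexP: t => c d.
  by rewrite -!kraus_gram -PhiA -PhiB.
exists D => p; apply: (can_inj mxvecK).
have := congr1 (row p) AD; rewrite rowK row_mul mulmx_sum_row linear_sum => ->.
by apply: eq_bigr => r _; rewrite rowK linearZ mxE.
Qed.

(** The inclusion of the graph can be tested on a single Kraus family. *)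
Lemma channel_graph_sub m n k (S : {vspace 'M[C]_n}) (Phi : 'M[C]_n -> 'M[C]_k)
    (B : 'I_m -> 'M[C]_(k, n)) :
  kraus_representation Phi B -> (forall r s, (B r) ^t* *m B s \in S) ->
  channel_graph Phi `<=` [set` S].
Proof.
move=> PhiB BS X [l [A [PhiA XA]]]; rewrite /=; apply: subvP _ XA.
apply/span_subvP => _ /fintype.imageP[[p q] _ ->] /=.
have [D AD] := kraus_span PhiA PhiB.
rewrite !AD adjmx_sum mulmx_suml rpred_sum// => r _.
rewrite mulmx_sumr rpred_sum// => s _.
by rewrite adjmxZ -scalemxAl -scalemxAr !rpredZ.
Qed.

Lemma channel_graph_mem m n k (S : {vspace 'M[C]_n}) (Phi : 'M[C]_n -> 'M[C]_k)
    (A : 'I_m -> 'M[C]_(k, n)) :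
  kraus_representation Phi A -> channel_graph Phi `<=` [set` S] ->
  forall p q, (A p) ^t* *m A q \in S.
Proof.
move=> PhiA gS p q; apply: gS; exists m, A; split=> //.
by apply: memv_span; apply/fintype.imageP; exists (p, q).
Qed.

(** * Linear inequalities on closed convex hulls *)

(** Values in R[i] are compared by a partial order, so the closedness of the
    nonnegative cone is used in the form z = |z|: an approximation of
    z = c - f X within M e by a nonnegative number gives
    |z - |z|| <= 2 M e. *)
Lemma closed_hull_le n (E : set 'M[C]_n) (f : 'M[C]_n -> C) (c : C) :
  scalar f -> (forall Y, E Y -> f Y <= c) ->
  forall X, closed_convex_hull E X -> f X <= c.
Proof.
move=> flin fE.
pose F : {scalar 'M[C]_n} := HB.pack f (GRing.isLinear.Build _ _ _ _ f flin).
have -> : f = F by [].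
have {}fE : forall Y, E Y -> F Y <= c by [].
move: F fE => {flin} {}f fE.
have fhull Y : convex_hull E Y -> f Y <= c.
  move=> [m [w [Z [w0 w1 EZ ->]]]]; rewrite linear_sum /=.
  have -> : c = \sum_i real_complex R (w i) * c.
    by rewrite -mulr_suml -rmorph_sum w1 rmorph1 mul1r.
  apply: ler_sum => i _; rewrite linearZ /= ler_wpM2l ?fE//.
  by rewrite lecR.
move=> X cX; rewrite -subr_ge0; set z := c - f X.
suff /eqP : z - `|z| = 0 by rewrite subr_eq0 => /eqP ->.
apply: contrapT => /eqP; rewrite -normr_gt0 => d0.
set d := `|_| in d0 *.
pose M := \sum_i \sum_j `|f (delta_mx i j)|.
have M0 : 0 <= M by apply: sumr_ge0 => i _; apply: sumr_ge0.
have M20 : 0 < M *+ 2 + 1 by rewrite ltr_wpDl// mulrn_wge0.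
(* The term 1 makes 2 M e < d, also when M = 0, against the bound d <= 2 M e
   derived below. *)
pose e := d / (M *+ 2 + 1).
have e0 : 0 < e by rewrite divr_gt0.
have [Y [hY [_ XY]]] := cX _ (nbhsx_ballx (X : 'M[C^o]_n) e e0).
have w0 : 0 <= c - f Y by rewrite subr_ge0 fhull.
have zw : `|z - (c - f Y)| <= M * e.
  have -> : z - (c - f Y) = f (Y - X).
    by rewrite [RHS]linearB /z opprB /=; ring.
  rewrite [Y - X]matrix_sum_delta linear_sum mulr_suml.
  apply: le_trans (ler_norm_sum _ _ _) _; apply: ler_sum => i _.
  rewrite linear_sum mulr_suml.
  apply: le_trans (ler_norm_sum _ _ _) _; apply: ler_sum => j _.
  rewrite linearZ /= normrM mulrC ler_wpM2l// !mxE distrC ltW//.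
  exact: XY.
have : d <= M * e + M * e.
  have -> : d = `|(z - (c - f Y)) + (`|c - f Y| - `|z|)|.
    by rewrite (ger0_norm w0) addrA subrK.
  apply: le_trans (ler_normD _ _) _; apply: lerD => //.
  by apply: le_trans (ler_dist_dist _ _) _; rewrite distrC.
have Me : (M *+ 2 + 1) * e = d by rewrite mulrCA divff ?mulr1// gt_eqF.
rewrite -mulrDl -mulr2n -{1}Me mulrDl mul1r gerDl => /(lt_le_trans e0).
by rewrite ltxx.
Qed.

(** * Abelian projections *)

(** The cross terms vanish, so Q = sum_i K_i has Q^2 = sum_i K_i^2 <= Q. *)
Lemma orthogonal_psd_sum_le1 (I : finType) n (K : I -> 'M[C]_n) :
  (forall i, psd (K i)) -> (forall i, \tr (K i) <= 1) ->
  (forall i j, i != j -> K i *m K j = 0) -> psd (1%:M - \sum_i K i).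
Proof.
move=> K0 K1 Kij; apply: psd_contraction.
  by apply: psd_hermitian; exact: psd_sum.
have -> : (\sum_i K i) *m (\sum_i K i) = \sum_i K i *m K i.
  rewrite mulmx_suml; apply: eq_bigr => i _.
  rewrite mulmx_sumr (bigD1 i)//= big1 ?addr0// => j ij.
  by rewrite Kij// eq_sym.
by rewrite -sumrB; apply: psd_sum => i; exact: psd_square_le.
Qed.

(** A unitary triangularizes all members simultaneously; adjoints being members
    too, the entries on the other side of the diagonal vanish as well. *)
Lemma commuting_diagonalization n (As : seq 'M[C]_n) :
  {in As &, forall A B, A *m B = B *m A} ->
  {in As, forall A, A ^t* \in As} ->
  exists2 U : 'M[C]_n, U \is unitarymx &
    {in As, forall A i j, i != j -> (U *m A *m U ^t*) i j = 0}.
Proof.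
move=> Acomm Aadj; have [U Uu Utrig] := cotrigonalization Acomm.
exists U => // A As_A i j.
have trig B : B \in As -> forall i j : 'I_n, (i < j)%N -> (U *m B *m U ^t*) i j = 0.
  move=> hB; apply/is_trig_mxP; rewrite -conjymx//.
  by have /allP /(_ _ hB) := Utrig.
rewrite neq_ltn => /orP[ij|ji]; first exact: (trig A As_A i j ij).
have := trig (A ^t*) (Aadj A As_A) j i ji.
have -> : U *m A ^t* *m U ^t* = (U *m A *m U ^t*) ^t*.
  by rewrite !adjmxM trmxCK mulmxA.
by rewrite mxE [X in X ^*]mxE => /eqP; rewrite conjC_eq0 => /eqP.
Qed.

Lemma projection_compl_psd n (P : 'M[C]_n) : projection P -> psd (1%:M - P).
Proof.
move=> [PP Ph]; apply: psd_contraction => //.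
by rewrite PP subrr => v; rewrite mulmx0 mul0mx mxE.
Qed.

(** P splits into rank one pieces whose images under the channel are mutually
    orthogonal; trace preservation bounds each image. *)
Lemma channel_abelian_le1 (n k m : nat) (S : {vspace 'M[C]_n})
    (Phi : 'M[C]_n -> 'M[C]_k) (A : 'I_m -> 'M[C]_(k, n)) P :
  kraus_representation Phi A -> trace_preserving Phi ->
  (forall p q, (A p) ^t* *m A q \in S) -> abelian_projection S P ->
  loewner (Phi P) 1%:M.
Proof.
move=> PhiE tpPhi AS [[PP Ph] [D [_ _ Dcomm] SD]].
pose X p q := P *m ((A p) ^t* *m A q) *m P.
have XD p q : X p q \in D by apply: SD.
have Xadj p q : (X p q) ^t* = X q p.
  by rewrite /X !adjmxM trmxCK Ph !mulmxA.
pose Xs := [seq X pq.1 pq.2 | pq : 'I_m * 'I_m].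
have XsP B : B \in Xs -> exists p q, B = X p q.
  by move=> /fintype.imageP[[p q] _ ->]; exists p, q.
have Xs_mem p q : X p q \in Xs by apply/fintype.imageP; exists (p, q).
have [||U Uu Udiag] := @commuting_diagonalization n Xs.
- move=> _ _ /XsP[p [q ->]] /XsP[p' [q' ->]]; exact: Dcomm.
- by move=> _ /XsP[p [q ->]]; rewrite Xadj.
(* Compressing the diagonalizing basis by P gives vectors of norm at most 1
   whose rank one matrices sum to P. *)
pose e i : 'cV[C]_n := P *m (row i U) ^t*.
pose K i := Phi (e i *m (e i) ^t*).
have sumU : \sum_i (row i U) ^t* *m row i U = 1%:M.
  rewrite -(mulmx1C (unitarymxP Uu)); apply/matrixP => a b.
  by rewrite summxE mxE; apply: eq_bigr => i _; rewrite mxE big_ord1 !mxE.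
have PE : P = \sum_i e i *m (e i) ^t*.
  under eq_bigr => i _ do rewrite /e adjmxM trmxCK Ph mulmxA -(mulmxA P).
  by rewrite -mulmx_suml -mulmx_sumr sumU mulmx1 PP.
have -> : Phi P = \sum_i K i.
  rewrite {1}PE PhiE; under [RHS]eq_bigr => i _ do rewrite /K PhiE.
  rewrite exchange_big; apply: eq_bigr => p _.
  by rewrite mulmx_sumr mulmx_suml.
apply: orthogonal_psd_sum_le1.
- move=> i; apply: (kraus_psd PhiE).
  by rewrite -{1}[e i]trmxCK; exact: psd_gram.
- move=> i; rewrite /K tpPhi mxtrace_mulC trace_mx11.
  rewrite /e adjmxM trmxCK Ph mulmxA -(mulmxA _ P P) PP -subr_ge0.
  have := projection_compl_psd (conj PP Ph) ((row i U) ^t*).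
  rewrite mulmxBr mulmxBl mxE [X in _ + X]mxE trmxCK mulmx1.
  have -> : row i U *m (row i U) ^t* = 1%:M.
    have /matrixP/(_ i i) := unitarymxP Uu; rewrite !mxE eqxx => UU.
    apply/matrixP => a b; rewrite !ord1 !mxE eqxx -UU.
    by apply: eq_bigr => l _; rewrite !mxE.
  by rewrite [(1%:M : 'M[C]_1) _ _]mxE.
- move=> i j ij; rewrite /K !PhiE mulmx_suml big1// => p _.
  rewrite mulmx_sumr big1// => q _.
  (* The middle factor is the off-diagonal entry of a diagonalized matrix. *)
  suff eXe : (e i) ^t* *m (A p) ^t* *m A q *m e j = 0.
    have -> : A p *m (e i *m (e i) ^t*) *m (A p) ^t* *m
        (A q *m (e j *m (e j) ^t*) *m (A q) ^t*) =
        A p *m e i *m ((e i) ^t* *m (A p) ^t* *m A q *m e j) *m (e j) ^t*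
          *m (A q) ^t* by rewrite !mulmxA.
    by rewrite eXe mulmx0 !mul0mx.
  have -> : (e i) ^t* *m (A p) ^t* *m A q *m e j =
      row i U *m X p q *m (row j U) ^t*.
    by rewrite /e /X adjmxM trmxCK Ph !mulmxA.
  apply/matrixP => a b; rewrite !ord1 [RHS]mxE -(Udiag _ (Xs_mem p q) i j ij).
  rewrite -[row i U *m _]row_mul !mxE; apply: eq_bigr => l _; by rewrite !mxE.
Qed.

(** * Full projections *)

Section CornerChannel.
Variables (n : nat) (P : 'M[C]_n).

(** Index 0 carries the part 1 - P and the indices 1 + j carry the rows of P,
    each placed in output coordinate 0. *)
Definition corner_kraus (r : 'I_(1 + n)) : 'M[C]_(1 + n, n) :=
  match fintype.split r with
  | inl _ => col_mx 0 (1%:M - P)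
  | inr j => delta_mx 0 j *m P
  end.

(** The map X |-> tr(PX) (+) (1-P)X(1-P), given by its Kraus operators. *)
Definition corner_channel (T : 'M[C]_n) : 'M[C]_(1 + n) :=
  \sum_r corner_kraus r *m T *m (corner_kraus r) ^t*.

Lemma corner_channel_linear : linear corner_channel.
Proof.
move=> a X Y; rewrite /corner_channel scaler_sumr -big_split.
apply: eq_bigr => r _.
by rewrite mulmxDr mulmxDl -scalemxAr -scalemxAl.
Qed.

HB.instance Definition _ :=
  GRing.isLinear.Build _ _ _ _ corner_channel corner_channel_linear.

Lemma corner_krausl i : corner_kraus (lshift n i) = col_mx 0 (1%:M - P).
Proof. by rewrite /corner_kraus (unsplitK (inl i)). Qed.

Lemma corner_krausr j : corner_kraus (rshift 1 j) = delta_mx 0 j *m P.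
Proof. by rewrite /corner_kraus (unsplitK (inr j)). Qed.

Lemma adj_compl_col : P ^t* = P ->
  (col_mx 0 (1%:M - P) : 'M[C]_(1 + n, n)) ^t*
  = row_mx 0 (1%:M - P).
Proof.
by move=> Ph; rewrite tr_col_mx map_row_mx adjmxB adjmx1 Ph trmx0 map_mx0.
Qed.

Lemma delta_col_mx0 m (j : 'I_m) :
  (delta_mx j 0 : 'M[C]_(m, 1 + n)) *m col_mx 0 (1%:M - P) = 0.
Proof.
apply/matrixP => a b; rewrite !mxE big_ord_recl /= big1 ?addr0 => [|i _].
  rewrite [X in _ * X](_ : _ = 0) ?mulr0//.
  have -> : ord0 = lshift n (0 : 'I_1) by apply/val_inj.
  by rewrite col_mxEu mxE.
by rewrite !mxE andbF mul0r.
Qed.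

(** The products are P E_ij P, in S as P is full, then 1 - P, in S as S contains
    1 and P, and 0 because the two parts have disjoint output coordinates. *)
Lemma corner_channel_graph (S : {vspace 'M[C]_n}) :
  operator_system S -> full_projection S P ->
  forall r s, (corner_kraus r) ^t* *m corner_kraus s \in S.
Proof.
move=> [S1 Sadj] [[PP Ph] SP].
have PS : P \in S by apply: SP; rewrite !PP.
have P'S : 1%:M - P \in S by rewrite rpredB.
have cross j : (delta_mx 0 j *m P) ^t* *m (col_mx 0 (1%:M - P) : 'M[C]_(1 + n, n)) = 0.
  by rewrite adjmxM adjmx_delta -mulmxA delta_col_mx0 mulmx0.
move=> r s; case: (split_ordP r) => i ->; case: (split_ordP s) => j ->.
- rewrite !corner_krausl (adj_compl_col Ph) mul_row_col mul0mx add0r.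
  by rewrite mulmxBr !mulmxBl !mul1mx mulmx1 PP subrr subr0.
- rewrite corner_krausl corner_krausr -[X in X \in S]trmxCK adjmxM trmxCK cross.
  by rewrite trmx0 map_mx0 mem0v.
- by rewrite corner_krausl corner_krausr cross mem0v.
- rewrite !corner_krausr adjmxM adjmx_delta Ph mulmxA -(mulmxA P) mul_delta_mx.
  by apply: SP; rewrite !mulmxA PP -!mulmxA PP.
Qed.

(** The sum of K^* K over the Kraus operators is P + (1 - P). *)
Lemma corner_channel_tp : projection P -> trace_preserving corner_channel.
Proof.
move=> [PP Ph] T; rewrite /corner_channel raddf_sum /=.
under eq_bigr => r _ do rewrite mxtrace_mulC mulmxA.
rewrite -raddf_sum /= -mulmx_suml big_split_ord big_ord1 /= corner_krausl.
under eq_bigr => j _ do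
  rewrite corner_krausr adjmxM adjmx_delta Ph mulmxA -(mulmxA P) mul_delta_mx.
rewrite -mulmx_suml -mulmx_sumr -[X in P *m X]mx1_sum_delta mulmx1 PP.
rewrite (adj_compl_col Ph) mul_row_col mul0mx add0r.
by rewrite mulmxBr !mulmxBl !mul1mx mulmx1 PP subrr subr0 subrK mul1mx.
Qed.

(** tr(PT) = sum_j (PTP)_jj is the entry of the image at output coordinate 0,
    where the Kraus operator of 1 - P contributes nothing. *)
Lemma corner_channel_corner T :
  projection P -> loewner (corner_channel T) 1%:M -> \tr (P *m T) <= 1.
Proof.
move=> [PP Ph]; pose v : 'cV[C]_(1 + n) := delta_mx 0 0.
move=> /(_ v); rewrite mulmxBr mulmxBl mxE [X in _ + X]mxE subr_ge0.
rewrite [leRHS]mx_delta_delta [leRHS]mxE eqxx.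
rewrite /corner_channel mulmx_sumr mulmx_suml summxE big_split_ord big_ord1 /=.
have -> : v ^t* *m (corner_kraus (lshift n 0) *m T *m (corner_kraus (lshift n 0)) ^t*)
  *m v = 0.
  rewrite corner_krausl !mulmxA.
  have -> : v ^t* *m col_mx 0 (1%:M - P) = 0; last by rewrite !mul0mx.
  by rewrite adjmx_delta delta_col_mx0.
rewrite [X in X + _]mxE add0r.
congr (_ <= _).
have -> : \tr (P *m T) = \tr (P *m T *m P).
  by rewrite [RHS]mxtrace_mulC mulmxA PP.
apply: eq_bigr => j _.
rewrite corner_krausr adjmxM adjmx_delta Ph -[RHS]mx_delta_delta !adjmx_delta.
by rewrite !mulmxA mul_delta_mx -!mulmxA mul_delta_mx.
Qed.

End CornerChannel.

End ComplexMatrices.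

Theorem theorem4p7 (R : realType) (n : nat) (S : {vspace 'M[R[i]]_n})
    (hS : operator_system S) :
  ap S `<=` th S /\ th S `<=` sharp (fp S).
Proof.
split=> [A [A0 [B hB AB]]|T [T0 hT]].
  split=> // k Phi [[cpPhi tpPhi] graphPhi].
  have [m [K PhiK]] := choi cpPhi.
  have KS := channel_graph_mem PhiK graphPhi.
  have PhiAB : psd (Phi B - Phi A) by rewrite -linearB; exact: (kraus_psd PhiK).
  have -> : loewner (Phi A) 1%:M = psd ((Phi B - Phi A) + (1%:M - Phi B)).
    by rewrite /loewner [X in _ = psd X]addrC addrA subrK.
  apply: psdD => // v; rewrite mulmxBr mulmxBl mxE [X in _ + X]mxE subr_ge0.
  apply: (closed_hull_le (f := fun X => (v ^t* *m Phi X *m v) 0 0)) hB => [a X Y|P hP].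
    by rewrite linearP mulmxDr mulmxDl -scalemxAr -scalemxAl !mxE.
  have := channel_abelian_le1 PhiK tpPhi KS hP.
  by move=> /(_ v); rewrite mulmxBr mulmxBl mxE [X in _ + X]mxE subr_ge0.
split=> // A [A0 [B hB AB]].
apply: (@le_trans _ _ (\tr (B *m T))).
  by rewrite -subr_ge0 -raddfB -mulmxBl; exact: trace_psd_ge0.
apply: (closed_hull_le (f := fun X => \tr (X *m T))) hB => [a X Y|P hP].
  by rewrite mulmxDl raddfD -scalemxAl /= mxtraceZ.
apply: (corner_channel_corner hP.1); apply: hT.
have PhiK : kraus_representation (corner_channel P) (corner_kraus P) by [].
split; last exact: (channel_graph_sub PhiK (corner_channel_graph hS hP)).
by split; [exact: kraus_cp PhiK | exact: corner_channel_tp hP.1].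
Qed.
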